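(* Let $\Lambda_\varepsilon=\{\lambda_\varepsilon\}$, $\varepsilon\in E=[0,\epsilon]$, be a family of hyperbolic fixed points of the ODEs $q'=f_\varepsilon(q)$ in $\mathbb{R}^{2k}$, with $k$-dimensional unstable and stable manifolds $W^u_{\Lambda_\varepsilon},W^s_{\Lambda_\varepsilon}$ having $C^2$ parameterisations $w^u,w^s$ and local coordinates $(x,y)\in\mathbb{R}^k\times\mathbb{R}^k$ as described in the context. Let $U\subset\mathbb{R}^k$ be open and let $\mathrm{u},\mathrm{s}:E\times U\to\mathbb{R}^k$ be $C^2$ functions such that for all $\varepsilon\in E$, $x\in U$ $$\pi_xw^u(\varepsilon,\mathrm{u}(\varepsilon,x))=x,\qquad \pi_xw^s(\varepsilon,\mathrm{s}(\varepsilon,x))=x,$$ and define $y:E\times U\to\mathbb{R}^k$ by $$y(\varepsilon,x)=\pi_yw^u(\varepsilon,\mathrm{u}(\varepsilon,x))-\pi_yw^s(\varepsilon,\mathrm{s}(\varepsilon,x)).$$ Assume that for some splitting $k=k_1+k_2$, $x=(x_1,x_2)$, $y=(y_1,y_2)$ (both in $\mathbb{R}^{k_1}\times\mathbb{R}^{k_2}$), one has: $U=B(p,R)$ for some $R>0$ and $p\in\mathbb{R}^k$ with $y(0,p)=0$; $y_2(0,x)=0$ for all $x\in U$; and, with $$A_{11}=\frac{\partial y_1}{\partial x_1}(0,p),\quad A_{22}=\frac{\partial^2 y_2}{\partial\varepsilon\partial x_2}(0,p),\quad \Delta_1=\left[\frac{\partial y_1}{\partial x}(E,U)-(A_{11},0)\right],\quad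 \Delta_2=\left[\frac{\partial^2 y_2}{\partial\varepsilon\partial x}(E,U)-(0,A_{22})\right],$$ the inequalities $$m(A_{11})R>\epsilon\left\|\frac{\partial y_1}{\partial\varepsilon}(E,p)\right\|+\|\Delta_1\|R,\qquad m(A_{22})R>\left\|\frac{\partial y_2}{\partial\varepsilon}(E,p)\right\|+\|\Delta_2\|R$$ hold. Then for any $\varepsilon\in(0,\epsilon]$ the manifolds $W^u_{\Lambda_\varepsilon}$ and $W^s_{\Lambda_\varepsilon}$ intersect transversally.
   Context: Dynamical setting. $q'=f_\varepsilon(q)$ is a smooth family of ODEs in $\mathbb{R}^n$, $n=2k$, with parameter $\varepsilon\in E=[0,\epsilon]$, $\epsilon>0$, and flow $\Phi^\varepsilon_t$. For each $\varepsilon\in E$ the point $\lambda_\varepsilon$ is a hyperbolic fixed point whose unstable and stable manifolds $W^u_{\Lambda_\varepsilon}=\{q:\lim_{t\to-\infty}\Phi^\varepsilon_t(q)=\lambda_\varepsilon\}$ and $W^s_{\Lambda_\varepsilon}=\{q:\lim_{t\to+\infty}\Phi^\varepsilon_t(q)=\lambda_\varepsilon\}$ are both of dimension $k$. With $B_k$ the unit ball in $\mathbb{R}^k$, $w^u,w^s:E\times B_k\to\mathbb{R}^n$ are $C^2$ functions such that, for each $\varepsilon$, $w^u(\varepsilon,\cdot)$ and $w^s(\varepsilon,\cdot)$ parameterise (local) pieces of the manifolds $W^u_{\Lambda_\varepsilon}$ and $W^s_{\Lambda_\varepsilon}$, respectively. Local coordinates. Locally in $\mathbb{R}^n$ there are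 coordinates $(x,y)\in\mathbb{R}^k\times\mathbb{R}^k$, with projections $\pi_x,\pi_y$, such that: (A) every matrix in $[\frac{\partial \pi_xw^u}{\partial\mathrm{u}}(E\times\overline{U'})]$ is invertible, and (B) every matrix in $[\frac{\partial\pi_xw^s}{\partial\mathrm{s}}(E\times\overline{S'})]$ is invertible, where $U',S'\subset\mathbb{R}^k$ are bounded open sets of parameters (with $\overline{U'},\overline{S'}$ in the domains of the parameterisations and with images in the coordinate region); $U\subset\pi_xw^u(E\times U')\cap\pi_xw^s(E\times S')$, and $\mathrm{u},\mathrm{s}$ take values in $U'$, $S'$. Notation. Fix norms on $\mathbb{R}^{k_1},\mathbb{R}^{k_2}$ and put $\|(x_1,x_2)\|=\max(\|x_1\|,\|x_2\|)$; $B(p,R)$ is the open ball in this norm; matrix norms are induced operator norms; $\|S\|=\sup_{s\in S}\|s\|$ for a set $S$. $m(A)=1/\|A^{-1}\|$ if $\det A\ne0$, else $m(A)=0$. $g(E,U)=\{g(\varepsilon,x):\varepsilon\in E,x\in U\}$ and $g(E,p)=\{g(\varepsilon,p):\varepsilon\in E\}$. $[S]$ is an interval enclosure: a product of closed intervals (one for each entry) containing $S$. $(A_{11},0)$ and $(0,A_{22})$ are block matrices of sizes $k_1\times k$ and $k_2\times k$. If $k_1=0$ or $k_2=0$ the corresponding inequality is omitted. *)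

(* Defs.v *)
From HB Require Import structures.
From mathcomp Require Import all_boot all_order all_algebra.
From mathcomp Require Import complex.
From mathcomp Require Import all_classical all_reals all_analysis.
Import Order.TTheory GRing.Theory Num.Theory.
Import numFieldNormedType.Exports.

Set Implicit Arguments.
Unset Strict Implicit.
Unset Printing Implicit Defensive.

Local Open Scope classical_set_scope.
Local Open Scope ring_scope.

(* Points of R^n are row vectors and matrices act on the right, as in the
   library: 'J g a is the transpose of the usual derivative matrix, and the
   k1 x k block matrix (A11, 0) of the column convention is col_mx A11 0. *)

Section Smoothness.
Context {R : realType} {V W : normedModType R}.

(* g is of class C^m at the points of O, meant for O open and V of finite
   dimension; there, continuity of p |-> 'd g p in operator norm is the same as
   continuity of p |-> 'd g p v for every v. *)
Fixpoint class_C (m : nat) (O : set V) (g : V -> W) : Prop :=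
  if m is m'.+1 then
    (forall p, O p -> differentiable g p) /\
    (forall v, class_C m' O (fun p => 'd g p v))
  else forall p, O p -> {for p, continuous g}.

(* On a set that need not be open, such as [0, eps] x U, being C^m means being
   C^m on an open neighbourhood of the set. *)
Definition class_C_on (m : nat) (D : set V) (g : V -> W) : Prop :=
  exists O : set V, [/\ open O, D `<=` O & class_C m O g].

Definition smooth_on (D : set V) (g : V -> W) : Prop :=
  exists O : set V, [/\ open O, D `<=` O & forall m, class_C m O g].

End Smoothness.

Section Dynamics.
Context {R : realType} {n : nat}.
Implicit Types (g : 'rV[R]_n -> 'rV[R]_n) (J : set R) (q lam : 'rV[R]_n).

Definition solves g J (x : R -> 'rV[R]_n) : Prop :=
  forall t, J t -> is_derive t 1 x (g (x t)).

(* Phi is the maximal flow of q' = g(q): the solution through q lives on the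
   open interval T q, and Phi t q is meaningful for t in T q only.  The flow is
   complete when T q = setT for all q, which is not required. *)
Definition is_flow g (T : 'rV[R]_n -> set R)
    (Phi : R -> 'rV[R]_n -> 'rV[R]_n) : Prop :=
  forall q,
    [/\ [/\ open (T q), is_interval (T q) & T q 0],
        Phi 0 q = q,
        solves g (T q) (fun t => Phi t q) &
        forall J x, open J -> is_interval J -> J 0 -> x 0 = q ->
          solves g J x -> J `<=` T q].

Definition unstable_set (T : 'rV[R]_n -> set R)
    (Phi : R -> 'rV[R]_n -> 'rV[R]_n) lam : set 'rV[R]_n :=
  [set q | (forall t, t <= 0 -> T q t) /\ Phi t q @[t --> -oo] --> lam].

Definition stable_set (T : 'rV[R]_n -> set R)
    (Phi : R -> 'rV[R]_n -> 'rV[R]_n) lam : set 'rV[R]_n :=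
  [set q | (forall t, 0 <= t -> T q t) /\ Phi t q @[t --> +oo] --> lam].

Definition hyperbolic_fixed_point g lam : Prop :=
  g lam = 0 /\
  forall z : R[i], eigenvalue (map_mx (real_complex R) ('J g lam)) z ->
    complex.Re z != 0.

End Dynamics.

Section Manifolds.
Context {R : realType} {k n : nat}.

(* c exhibits W as a k-dimensional injectively immersed submanifold of R^n.
   The (un)stable manifold of a hyperbolic fixed point is in general not
   embedded, but it is an injectively immersed copy of R^k. *)
Definition immersed_manifold (W : set 'rV[R]_n) (c : 'rV[R]_k -> 'rV[R]_n) :
    Prop :=
  [/\ range c = W, injective c, class_C 1 setT c &
      forall a, row_free ('J c a)].

(* w parameterises, over the open set D, a piece of the manifold immersed by c:
   read through c, it is a C^1 diffeomorphism h from D onto an open subset. *)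
Definition parameterises (c : 'rV[R]_k -> 'rV[R]_n) (D : set 'rV[R]_k)
    (w : 'rV[R]_k -> 'rV[R]_n) : Prop :=
  exists h : 'rV[R]_k -> 'rV[R]_k,
    [/\ class_C 1 D h, {in D &, injective h},
        forall a, D a -> 'J h a \in unitmx &
        forall a, D a -> w a = c (h a)].

Definition tangent_space (c : 'rV[R]_k -> 'rV[R]_n) (q : 'rV[R]_n) :
    set 'rV[R]_n :=
  [set v | exists2 a, c a = q & exists b : 'rV[R]_k, v = b *m 'J c a].

Definition transversal_at (c1 c2 : 'rV[R]_k -> 'rV[R]_n) (q : 'rV[R]_n) :
    Prop :=
  [/\ range c1 q, range c2 q &
      forall v, exists v1 v2, [/\ tangent_space c1 q v1,
        tangent_space c2 q v2 & v = v1 + v2]].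

Definition unit_ball : set 'rV[R]_k := [set a | \sum_i a 0 i ^+ 2 < 1].

End Manifolds.

Section Coordinates.
Context {R : realType} {k : nat}.
Implicit Types psi : 'rV[R]_(k + k) -> 'rV[R]_(k + k).

(* psi = (x, y) is a system of local coordinates on the region O. *)
Definition local_coordinates (O : set 'rV[R]_(k + k)) psi : Prop :=
  [/\ open O, class_C 2 O psi, {in O &, injective psi} &
      forall q, O q -> 'J psi q \in unitmx].

Definition pi_x psi (q : 'rV[R]_(k + k)) : 'rV[R]_k := lsubmx (psi q).
Definition pi_y psi (q : 'rV[R]_(k + k)) : 'rV[R]_k := rsubmx (psi q).

Definition gap psi (wu ws : R * 'rV[R]_k -> 'rV[R]_(k + k))
    (u s : R * 'rV[R]_k -> 'rV[R]_k) (z : R * 'rV[R]_k) : 'rV[R]_k :=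
  pi_y psi (wu (z.1, u z)) - pi_y psi (ws (z.1, s z)).

End Coordinates.

Section PartialDerivatives.
Context {R : realType} {k l : nat}.

Definition d_x (g : R * 'rV[R]_k -> 'rV[R]_l) (e : R) (x : 'rV[R]_k) :
    'M[R]_(k, l) :=
  'J (fun x' => g (e, x')) x.

Definition d_eps (g : R * 'rV[R]_k -> 'rV[R]_l) (e : R) (x : 'rV[R]_k) :
    'rV[R]_l :=
  derive1 (fun e' => g (e', x)) e.

Definition d_eps_x (g : R * 'rV[R]_k -> 'rV[R]_l) (e : R) (x : 'rV[R]_k) :
    'M[R]_(k, l) :=
  derive1 (fun e' => d_x g e' x) e.

End PartialDerivatives.

Section Norms.
Context {R : realType}.

Definition is_norm (m : nat) (N : 'rV[R]_m -> R) : Prop :=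
  [/\ forall v, 0 <= N v, forall v, N v = 0 -> v = 0,
      forall a v, N (a *: v) = `|a| * N v &
      forall v w, N (v + w) <= N v + N w].

Definition max_norm (k1 k2 : nat) (N1 : 'rV[R]_k1 -> R) (N2 : 'rV[R]_k2 -> R)
    (v : 'rV[R]_(k1 + k2)) : R :=
  Num.max (N1 (lsubmx v)) (N2 (rsubmx v)).

Definition norm_ball (m : nat) (N : 'rV[R]_m -> R) (p : 'rV[R]_m) (r : R) :
    set 'rV[R]_m :=
  [set x | N (x - p) < r].

Definition set_norm (T : Type) (N : T -> R) (S : set T) : R := sup (N @` S).

Definition op_norm (m m' : nat) (N : 'rV[R]_m -> R) (N' : 'rV[R]_m' -> R)
    (A : 'M[R]_(m, m')) : R :=
  sup [set N' (v *m A) | v in [set v | N v <= 1]].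

Definition conorm (m : nat) (N : 'rV[R]_m -> R) (A : 'M[R]_m) : R :=
  if \det A != 0 then (op_norm N N (invmx A))^-1 else 0.

Definition mx_box (m m' : nat) (L H : 'M[R]_(m, m')) : set 'M[R]_(m, m') :=
  [set A | forall i j, L i j <= A i j <= H i j].

(* The interval matrix with end points L and H is an interval enclosure [S]. *)
Definition encloses (m m' : nat) (L H : 'M[R]_(m, m'))
    (S : set 'M[R]_(m, m')) : Prop :=
  S `<=` mx_box L H.

End Norms.

(* Main.v *)
(* Fix eps > 0.  As y2(0, .) = 0, the zeros of y(eps, .) are those of
   G(x) = (y1(eps, x), y2(eps, x) / eps).  Column by column, the mean value
   theorem (in x for y1, in the parameter for the x-derivative of y2) shows that
   the mean slopes of G differ from diag(A11, A22) by elements of the interval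
   matrices Delta1 and Delta2.  The two inequalities thus make the simplified
   Newton map x |-> x - diag(A11, A22)^-1 G(x) a contraction of a closed ball
   around p of radius less than R into itself.  At its fixed point the
   derivative of y(eps, .) is invertible for the same reason.  In the
   coordinates (x, y) both manifolds are graphs over x and y(eps, .) is the
   difference of the two graph functions, so this is transversality. *)
Require Import Defs.
From mathcomp Require Import all_boot all_order all_algebra.
From mathcomp Require Import all_classical all_reals all_analysis.
From mathcomp Require Import ring lra.
Import Order.TTheory GRing.Theory Num.Def Num.Theory.
Import numFieldNormedType.Exports.
Local Open Scope classical_set_scope.
Local Open Scope ring_scope.

Set Implicit Arguments.
Unset Strict Implicit.
Unset Printing Implicit Defensive.

(** * Norms on row vectors *)

Section NormTheory.
Context {R : realType} {m : nat} {N : 'rV[R]_m -> R}.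
Hypothesis nN : is_norm N.
Implicit Types v w : 'rV[R]_m.

Lemma is_norm_ge0 v : 0 <= N v. Proof. by have [] := nN. Qed.
Lemma is_normZ a v : N (a *: v) = `|a| * N v. Proof. by have [] := nN. Qed.
Lemma is_normD v w : N (v + w) <= N v + N w. Proof. by have [] := nN. Qed.
Lemma is_norm_eq0 v : N v = 0 -> v = 0.
Proof. by have [] := nN => _ + _ _; exact. Qed.

Lemma is_norm0 : N 0 = 0.
Proof. by rewrite -(scale0r 0) is_normZ normr0 mul0r. Qed.

Lemma is_normN v : N (- v) = N v.
Proof. by rewrite -scaleN1r is_normZ normrN1 mul1r. Qed.

Lemma is_norm_distC v w : N (v - w) = N (w - v).
Proof. by rewrite -is_normN opprB. Qed.

Lemma is_norm_dist v w : `|N v - N w| <= N (v - w).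
Proof.
have h a b : N a - N b <= N (a - b).
  by rewrite lerBlDr (le_trans _ (is_normD _ _))// subrK.
by rewrite ler_norml h andbT lerNl opprB is_norm_distC h.
Qed.

Lemma is_norm_sum (I : finType) (F : I -> 'rV[R]_m) :
  N (\sum_i F i) <= \sum_i N (F i).
Proof.
elim/big_ind2 : _ => [|v a w b va wb|//]; first by rewrite is_norm0.
by rewrite (le_trans (is_normD _ _)) ?lerD.
Qed.

(** Expansion of [v] in the standard basis; [|v|] is the largest absolute value of an entry. This
    half of the equivalence of norms makes [N] continuous. *)
Lemma is_norm_le_mx v :
  N v <= `|v| * \sum_i N (delta_mx 0 i).
Proof.
rewrite {1}[v]row_sum_delta (le_trans (is_norm_sum _))// mulr_sumr.
apply: ler_sum => i _; rewrite is_normZ ler_wpM2r ?is_norm_ge0//.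
rewrite [leRHS]/Num.Def.normr/= mx_normrE.
exact: (le_bigmax _ (fun ij : 'I_1 * 'I_m => `|v ij.1 ij.2|) (0, i)).
Qed.

Lemma is_norm_dist_continuous p : continuous (fun v => N (v - p)).
Proof.
move=> v; apply/(@cvgrPdist_lt _ _ _ (nbhs v)) => e e0.
set C := \sum_i N (delta_mx 0 i).
have C0 : 0 <= C by apply: sumr_ge0 => i _; exact: is_norm_ge0.
(* The divisor is [C + 1] because [C] vanishes when [m = 0]. *)
have eC : 0 < e / (C + 1) by rewrite divr_gt0// ltr_wpDl.
have := nbhsx_ballx v _ eC; apply: filterS => w; rewrite -ball_normE /= => vw.
rewrite (le_lt_trans (is_norm_dist _ _))// opprB addrA subrK.
rewrite (le_lt_trans (is_norm_le_mx _))//.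
rewrite (@le_lt_trans _ _ (`|v - w| * (C + 1)))// ?ler_wpM2l// ?lerDl//.
by rewrite -ltr_pdivlMr ?ltr_wpDl.
Qed.

Lemma is_norm_continuous : continuous N.
Proof.
rewrite (_ : N = fun v => N (v - 0)); first exact: is_norm_dist_continuous.
by apply/funext => v; rewrite subr0.
Qed.

(** The other half of the equivalence of norms: on the compact unit sphere of [|.|] the continuous
    function [N] attains a minimum, which is positive, and [c] is its inverse. *)
Lemma mx_le_is_norm : exists2 c, 0 < c & forall v, `|v| <= c * N v.
Proof.
pose S := [set v : 'rV[R]_m | `|v| = 1].
have [S0|S0] := pselect (S !=set0); last first.
  (* The sphere is empty only if every vector is zero, and then any constant works. *)
  exists 1 => // v; have [->|v0] := eqVneq v 0.
    by rewrite normr0 mulr_ge0 ?is_norm_ge0.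
  exfalso; apply: S0; exists (`|v|^-1 *: v).
  rewrite /S/= normrZ normfV normr_id.
  by rewrite mulVf// normr_eq0.
have cS : compact S.
  apply: bounded_closed_compact.
    by exists 1; split => // M M1 v /= ->; exact: ltW.
  rewrite (_ : S = (fun v => `|v|) @^-1` [set 1 : R]); last by [].
  apply: preimage_closed => [v _|]; first exact: norm_continuous.
  exact: closed_eq.
have [|a /set_mem aS amin] := @EVT_min_rV _ _ N S S0 cS.
  by apply: continuous_subspaceT; exact: is_norm_continuous.
have Na : 0 < N a.
  rewrite lt_neqAle is_norm_ge0 andbT eq_sym; apply/eqP => /is_norm_eq0 a0.
  by move: aS; rewrite /S/= a0 normr0 => /eqP; rewrite eq_sym oner_eq0.
exists (N a)^-1; rewrite ?invr_gt0// => v; have [->|v0] := eqVneq v 0.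
  by rewrite normr0 mulr_ge0 ?is_norm_ge0// invr_ge0 ltW.
rewrite mulrC ler_pdivlMr// mulrC -ler_pdivlMr ?normr_gt0//.
have /amin : `|v|^-1 *: v \in S.
  by rewrite inE /S/= normrZ normfV normr_id mulVf// normr_eq0.
by rewrite is_normZ normfV normr_id mulrC.
Qed.

Lemma is_norm_open_ball (p : 'rV[R]_m) r : open (norm_ball N p r).
Proof.
rewrite (_ : norm_ball N p r = (fun x => N (x - p)) @^-1` [set x | x < r])//.
apply: open_comp (@open_lt _ r).
by move=> x _; exact: is_norm_dist_continuous.
Qed.

Lemma compact_norm_ball (p : 'rV[R]_m) r : compact [set x | N (x - p) <= r].
Proof.
have [c c0 cN] := mx_le_is_norm.
apply: bounded_closed_compact.
  exists (`|p| + c * r); split => [|M pM x /= xr]; first exact: num_real.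
  rewrite -(subrK p x) addrC (le_trans (ler_normD _ _))//.
  rewrite (le_trans _ (ltW pM))//.
  by rewrite lerD2l (le_trans (cN _))// ler_wpM2l// ltW.
rewrite (_ : mkset _ = (fun x => N (x - p)) @^-1` [set x | x <= r])//.
apply: preimage_closed (@closed_le _ r).
by move=> x _; exact: is_norm_dist_continuous.
Qed.

(* Edelstein's argument: x |-> N (F x - x) attains its minimum on the compact
   ball, and F would decrease a positive minimum. *)
Lemma contraction_fixpoint (F : 'rV[R]_m -> 'rV[R]_m) (p : 'rV[R]_m) (r k : R) :
  0 <= r -> 0 <= k < 1 ->
  (forall x, N (x - p) <= r -> N (F x - p) <= r) ->
  (forall x x', N (x - p) <= r -> N (x' - p) <= r ->
     N (F x - F x') <= k * N (x - x')) ->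
  exists2 x, N (x - p) <= r & F x = x.
Proof.
move=> r0 /andP[k0 k1] Fr Fk; set A := [set x | N (x - p) <= r].
have A0 : A !=set0 by exists p; rewrite /A/= subrr is_norm0.
have [|x /set_mem Ax xmin] := 
    @EVT_min_rV _ _ (fun x => N (F x - x)) A A0 (@compact_norm_ball p r).
  (* [F] is controlled on the ball only, so continuity is relative to the ball. As [k < 1], the
     changes of [F x] and of [x] each contribute less than [e / 2]. *)
  apply/subspace_continuousP => x Ax; apply/cvgrPdist_lt => e e0.
  have cN : N (y - x) @[y --> x] --> 0.
    by have := @is_norm_dist_continuous x x;
      rewrite /continuous_at subrr is_norm0.
  have : \forall y \near x, N (y - x) < e / 2.
    by apply: cvgr_lt cN _ _; rewrite divr_gt0.
  apply: filterS => y ye Ay.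
  rewrite (le_lt_trans (is_norm_dist _ _))//.
  rewrite (_ : F x - x - _ = F x - F y + (y - x)); last first.
    by rewrite opprB addrACA [RHS]addrACA [- x - F y]addrC.
  rewrite (le_lt_trans (is_normD _ _))// [e]splitr ltrD//.
  rewrite (le_lt_trans (Fk _ _ Ax Ay))// is_norm_distC (le_lt_trans _ ye)//.
  by rewrite ler_piMl ?is_norm_ge0// ltW.
exists x => //; apply/eqP; rewrite -subr_eq0; apply/eqP/is_norm_eq0.
have FAx : A (F x) by exact: Fr.
have := le_trans (xmin _ (mem_set FAx)) (Fk _ _ FAx Ax).
have := is_norm_ge0 (F x - x); nra.
Qed.

End NormTheory.

Lemma max_norm_is_norm {R : realType} {k1 k2 : nat} (N1 : 'rV[R]_k1 -> R)
    (N2 : 'rV[R]_k2 -> R) :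
  is_norm N1 -> is_norm N2 -> is_norm (max_norm N1 N2).
Proof.
rewrite /max_norm => n1 n2; split=> [v|v|a v|v w].
- by rewrite le_max is_norm_ge0.
- move=> v0; rewrite -(hsubmxK v).
  have h1 : N1 (lsubmx v) <= 0 by rewrite -v0 le_max lexx.
  have h2 : N2 (rsubmx v) <= 0 by rewrite -v0 le_max lexx orbT.
  have e1 : lsubmx v = 0.
    by apply: (is_norm_eq0 n1); apply/eqP; rewrite eq_le h1 is_norm_ge0.
  have e2 : rsubmx v = 0.
    by apply: (is_norm_eq0 n2); apply/eqP; rewrite eq_le h2 is_norm_ge0.
  by rewrite e1 e2 row_mx0.
- by rewrite !linearZ/= (is_normZ n1) (is_normZ n2) maxr_pMr.
- rewrite !linearD/= ge_max; apply/andP; split.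
    by rewrite (le_trans (is_normD n1 _ _))// lerD// le_max lexx.
  by rewrite (le_trans (is_normD n2 _ _))// lerD// le_max lexx orbT.
Qed.

(** * Operator norms and interval matrices *)

Section OperatorNorm.
Context {R : realType} {m n : nat} {N : 'rV[R]_m -> R} {N' : 'rV[R]_n -> R}.
Hypotheses (nN : is_norm N) (nN' : is_norm N').

Lemma mulmx_norm_bound (A B : 'M[R]_(m, n)) v :
  (forall i j, `|A i j| <= B i j) ->
  N' (v *m A) <= `|v| * \sum_i \sum_j B i j * N' (delta_mx 0 j).
Proof.
move=> AB; rewrite mulmx_sum_row (le_trans (is_norm_sum nN' _))// mulr_sumr.
apply: ler_sum => i _; rewrite is_normZ//.
apply: ler_pM => //; first exact: is_norm_ge0.
  rewrite [leRHS]/Num.Def.normr/= mx_normrE.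
  exact: (le_bigmax _ (fun ij : 'I_1 * 'I_m => `|v ij.1 ij.2|) (0, i)).
rewrite [row i A]row_sum_delta (le_trans (is_norm_sum nN' _))//.
by apply: ler_sum => j _; rewrite is_normZ// ler_wpM2r ?is_norm_ge0// mxE.
Qed.

(** [K] depends only on the entrywise bound [B]. This uniformity bounds the operator norm of one
    matrix and also those of all members of an interval matrix. *)
Lemma op_norm_ubound (B : 'M[R]_(m, n)) : exists2 K, 0 <= K &
  forall A : 'M[R]_(m, n), (forall i j, `|A i j| <= B i j) ->
  forall v, N v <= 1 -> N' (v *m A) <= K.
Proof.
have [c c0 cN] := mx_le_is_norm nN.
exists (`|c * \sum_i \sum_j B i j * N' (delta_mx 0 j)|) => // A AB v v1.
rewrite (le_trans (mulmx_norm_bound v AB))// (le_trans (ler_norm _))//.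
rewrite !normrM normr_id ler_wpM2r//.
by rewrite gtr0_norm// (le_trans (cN v))// ler_piMr// ltW.
Qed.

(** [sup] is an upper bound only for nonempty bounded sets, so this precedes any use of
    [op_norm]. *)
Lemma op_norm_has_sup (A : 'M[R]_(m, n)) :
  has_sup [set N' (v *m A) | v in [set v | N v <= 1]].
Proof.
split; first by exists (N' (0 *m A)); exists 0 => //=; rewrite is_norm0.
have [K _ HK] := op_norm_ubound (map_mx normr A).
by exists K => _ [v v1 <-]; apply: HK => // i j; rewrite mxE.
Qed.

Lemma op_norm_ge0 (A : 'M[R]_(m, n)) : 0 <= op_norm N N' A.
Proof.
rewrite -(is_norm0 nN') -(mul0mx _ A).
apply: sup_upper_bound; first exact: op_norm_has_sup.
by exists 0 => //=; rewrite is_norm0.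
Qed.

Lemma op_normP (A : 'M[R]_(m, n)) v : N' (v *m A) <= op_norm N N' A * N v.
Proof.
have [v0|v0] := eqVneq (N v) 0.
  by rewrite (is_norm_eq0 nN v0) mul0mx !is_norm0// mulr0.
have Nv : 0 < N v by rewrite lt_neqAle eq_sym v0 is_norm_ge0.
rewrite -ler_pdivrMr//.
have -> : N' (v *m A) / N v = N' ((N v)^-1 *: v *m A).
  by rewrite -scalemxAl is_normZ// ger0_norm ?invr_ge0 ?is_norm_ge0// mulrC.
apply: sup_upper_bound; first exact: op_norm_has_sup.
exists ((N v)^-1 *: v) => //=.
by rewrite is_normZ// ger0_norm ?invr_ge0 ?is_norm_ge0// mulVf.
Qed.

(** Entries of members of the box are at most [|L i j| + |H i j|] in absolute value, so the operator
    norms over the box are bounded and [set_norm] is a true supremum. *)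
Lemma op_norm_box (L H A : 'M[R]_(m, n)) : mx_box L H A ->
  op_norm N N' A <= set_norm (op_norm N N') (mx_box L H).
Proof.
move=> bA; apply: sup_upper_bound; last by exists A.
split; first by exists (op_norm N N' A); exists A.
have [K _ HK] := op_norm_ubound (map_mx normr L + map_mx normr H).
exists K => _ [B bB <-]; apply: ge_sup; first by have [] := op_norm_has_sup B.
move=> _ [v v1 <-]; apply: HK => // i j; rewrite !mxE.
have /andP[h1 h2] := bB i j.
have := ler_norm (H i j); have := ler_norm (- L i j); rewrite normrN.
have := normr_ge0 (H i j); have := normr_ge0 (L i j).
by rewrite ler_norml => *; apply/andP; split; lra.
Qed.

End OperatorNorm.

(* This turns either inequality into the estimates behind one component of the
   Newton map, and covers the omitted case m = 0, where conorm N A = 0. *)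
Lemma conorm_gt (R : realType) (m l : nat) (N : 'rV[R]_m -> R)
    (Nk : 'rV[R]_l -> R) (L H : 'M[R]_(l, m)) (A : 'M[R]_m) (C r : R) :
  is_norm N -> is_norm Nk -> 0 < r -> 0 <= C -> mx_box L H !=set0 ->
  ((0 < m)%N ->
    conorm N A * r > C + set_norm (op_norm Nk N) (mx_box L H) * r) ->
  exists c k, [/\ 0 <= c, 0 <= k < 1, c + k * r < r,
    forall v, N v <= C -> N (v *m invmx A) <= c &
    forall M, mx_box L H M -> forall v, N (v *m M *m invmx A) <= k * Nk v] /\
    A \in unitmx.
Proof.
move=> nN nNk r0 C0 [M0 bM0]; case: (posnP m) => [m0 _|m0 /(_ isT)].
  (* On the zero space [N] vanishes, so both constants can be 0 and only [0 < r] is left to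
     check. *)
  exists 0, 0; subst m; split; last first.
    by rewrite (flatmx0 A) -(flatmx0 1%:M) unitmx1.
  split=> // [|||M _ v]; rewrite ?lexx ?ltr01 ?mul0r ?addr0//.
    by move=> v _; rewrite thinmx0 is_norm0.
  by rewrite thinmx0 is_norm0.
set D := set_norm _ _ => hC.
have D0 : 0 <= D by rewrite (le_trans _ (op_norm_box nNk nN bM0))// op_norm_ge0.
(* The right-hand side is nonnegative, so the strict inequality forces a positive conorm and
   excludes its default value 0 for singular [A]. *)
have hc : 0 < conorm N A by have := mulr_ge0 D0 (ltW r0); nra.
move: hC hc; rewrite /conorm; case: ifPn => [Au|]; last by rewrite ltxx.
rewrite invr_gt0; set a := op_norm N N (invmx A) => hC a0.
(* Multiplying the inequality by [a], the norm of the inverse of [A], gives [a * C + a * D * r < r];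
   since [a * C >= 0], this also yields [a * D < 1]. *)
exists (a * C), (a * D); split; last by rewrite unitmxE unitfE.
have aCD : a * C + a * D * r < r.
  by rewrite -mulrA -mulrDr -ltr_pdivlMl.
split => //.
- by rewrite mulr_ge0// ltW.
- apply/andP; split; first by rewrite mulr_ge0// ltW.
  have := mulr_ge0 (ltW a0) C0; nra.
- by move=> v vC; rewrite (le_trans (op_normP nN nN _ _))// ler_wpM2l// ltW.
- move=> M bM v; rewrite (le_trans (op_normP nN nN _ _))// -mulrA.
  apply: (ler_wpM2l (ltW a0)).
  rewrite (le_trans (op_normP nNk nN _ _))// ler_wpM2r ?is_norm_ge0//.
  exact: op_norm_box.
Qed.

(** * Mean value theorems *)

(** The part of class C^2 that the mean value arguments use. Second derivatives are expressed
    through fixed directions [v], which avoids a normed space of linear maps. *)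
Definition twice_differentiable_on (R : realType) (V W : normedModType R)
    (Om : set V) (h : V -> W) : Prop :=
  forall z, Om z ->
  differentiable h z /\ forall v, differentiable (fun z => 'd h z v) z.

(* The minimum over [a, b] of t |-> N (h t - h a) - C' (t - a), with C' > C,
   can only be attained at b, because this function decreases immediately to
   the right of every t < b. *)
Lemma is_norm_mean_value (R : realType) (m : nat) (N : 'rV[R]_m -> R)
    (h : R -> 'rV[R]_m) (a b C : R) :
  is_norm N -> a <= b ->
  (forall t, a <= t <= b -> derivable h t 1) ->
  (forall t, a <= t <= b -> N (derive1 h t) <= C) ->
  N (h b - h a) <= C * (b - a).
Proof.
move=> nN ab dh hC; have [->|a_b] := eqVneq a b.
  by rewrite !subrr is_norm0// mulr0.
have {a_b}ab' : a < b by rewrite lt_neqAle a_b.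
suff H C' : C < C' -> N (h b - h a) <= C' * (b - a).
  rewrite -ler_pdivrMr ?subr_gt0//; apply/ler_addgt0Pr => e e0.
  by rewrite ler_pdivrMr ?subr_gt0//; apply: H; rewrite ltrDl.
move=> CC'; pose phi t := N (h t - h a) - C' * (t - a).
have hcont t : a <= t <= b -> {for t, continuous h}.
  by move=> tab; apply: differentiable_continuous; apply/derivable1_diffP/dh.
have cphi : {within `[a, b], continuous phi}.
  apply/continuous_in_subspaceT => t; rewrite inE/= in_itv/= => tab.
  apply: cvgB.
    have := @continuous_comp _ _ _ h (fun v => N (v - h a)) t (hcont t tab).
    by move=> /(_ (@is_norm_dist_continuous _ _ _ nN (h a) (h t))); exact.
  by apply: cvgM; [exact: cvg_cst|apply: cvgB; [exact: cvg_id|exact: cvg_cst]].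
have [c /[!in_itv]/= /andP[ac cb] cmin] := EVT_min ab cphi.
have := cb; rewrite le_eqVlt => /predU1P[cb'|{}cb].
  have := cmin a; rewrite in_itv/= lexx ab => /(_ isT).
  by rewrite cb' /phi !subrr is_norm0// mulr0 subrr subr_le0.
have cab : a <= c <= b by rewrite ac ltW.
have := dh c cab; rewrite /derivable -/('D_1 h c) => dhc.
have Nd := cvg_comp _ _ dhc (is_norm_continuous nN (x := 'D_1 h c)).
have Dlt : N ('D_1 h c) < C' by rewrite -derive1E (le_lt_trans (hC _ cab)).
have [d /= d0 dN] := cvgr_lt _ Nd _ Dlt.
(* A step to the right of [c] that stays in [[a, b]] and is short enough for the difference quotient
   to have norm below [C']. *)
pose s := Num.min d (b - c) / 2.
have m0 : 0 < Num.min d (b - c) by rewrite lt_min d0 subr_gt0.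
have md : Num.min d (b - c) <= d by rewrite ge_min lexx.
have mc : Num.min d (b - c) <= b - c by rewrite ge_min lexx orbT.
have s0 : 0 < s by rewrite divr_gt0.
have sd : s < d by rewrite /s; lra.
have sbc : s <= b - c by rewrite /s; lra.
have := dN s; rewrite /= sub0r normrN gtr0_norm// => /(_ sd).
move=> /(_ (lt0r_neq0 s0)); rewrite /= is_normZ// normfV gtr0_norm//.
rewrite ltr_pdivrMl// [s *: 1]mulr1 => Ns.
have := cmin (s + c).
have -> : s + c \in `[a, b] by rewrite in_itv/=; apply/andP; split; lra.
move=> /(_ isT).
rewrite /phi leNgt => /negP[].
have := is_normD nN (h (s + c) - h c) (h c - h a); rewrite subrKA.
nra.
Qed.

Lemma is_derive_coord (R : realType) (m n : nat) (g : R -> 'M[R]_(m, n)) t i j :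
  derivable g t 1 -> is_derive t 1 (fun t => g t i j) (derive1 g t i j).
Proof.
move=> dg; apply: DeriveDef; first by move/derivable_mxP : dg; exact.
by rewrite derive1E derive_mx// mxE.
Qed.

(** The scalar mean value theorem is applied to each entry. The mean points may differ between
    entries, which is harmless because membership in a box is an entrywise condition. *)
Lemma difference_quotient_box (R : realType) (m n : nat)
    (G : R -> 'M[R]_(m, n)) (e : R) (B L H : 'M[R]_(m, n)) :
  0 < e -> (forall t, 0 <= t <= e -> derivable G t 1) ->
  (forall t, 0 <= t <= e -> mx_box L H (derive1 G t - B)) ->
  mx_box L H (e^-1 *: (G e - G 0) - B).
Proof.
move=> e0 dG bG i j.
have [t||t /[!in_itv]/= te] := @MVT_segment R
    (fun t => G t i j) (fun t => derive1 G t i j) 0 e (ltW e0).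
- rewrite in_itv/= => /andP[/ltW t0 /ltW te].
  by apply/is_derive_coord/dG; rewrite t0.
- apply: (@derivable_within_continuous _ _ (fun t => G t i j)).
  move=> s; rewrite in_itv/= => /dG ds.
  by have := is_derive_coord i j ds => /@ex_derive.
- rewrite subr0 => GE; have := bG t te i j; rewrite !mxE GE mulrC mulfK//.
  by rewrite gt_eqF.
Qed.

(** * Partial derivatives in the parameter and in space *)

Section PartialDerivativeFacts.
Context {R : realType} {k l : nat}.
Implicit Types (h : R * 'rV[R]_k -> 'rV[R]_l) (Om : set (R * 'rV[R]_k)).

Lemma d_xE h e x v : differentiable h (e, x) ->
  v *m d_x h e x = 'd h (e, x) (0, v).
Proof.
move=> dh; rewrite /d_x /jacobian mul_rV_lin1.
have dp : is_diff x (fun x' : 'rV[R]_k => (e, x')) (fun v => (0, v)).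
  exact: is_diff_pair.
rewrite (@diff_comp _ _ _ _ (fun x' : 'rV[R]_k => (e, x')) h)//=.
by rewrite diff_val.
Qed.

Lemma is_derive_line h z w t : differentiable h (z + t *: w) ->
  is_derive t 1 (fun t => h (z + t *: w)) ('d h (z + t *: w) w).
Proof.
move=> dh.
have dp : is_diff t (fun t : R => z + t *: w) (fun s => s *: w).
  have := @is_diffD _ _ _ (cst z) (fun s : R => s *: w) _ _ t
    (is_diff_cst z t) (is_diff_scalel t w).
  by rewrite add0r.
rewrite -/(h \o (fun t : R => z + t *: w)).
set p := fun t : R => z + t *: w in dp *.
have dc : differentiable (h \o p) t by apply: differentiable_comp.
apply: DeriveDef; first exact/derivable1_diffP.
rewrite (deriveE (1 : R) dc).
have -> := @diff_comp _ _ _ _ p h t (@ex_diff _ _ _ _ _ _ _ dp) dh.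
by rewrite /= (@diff_val _ _ _ _ _ _ _ dp) scale1r.
Qed.

(* The mean points differ from column to column, hence the interval matrix. *)
Lemma mean_value_box h (U : set 'rV[R]_k) (e : R) (B L H : 'M[R]_(k, l))
    (x x' : 'rV[R]_k) :
  (forall t : R, 0 <= t <= 1 -> U (x' + t *: (x - x'))) ->
  (forall x, U x -> differentiable h (e, x)) ->
  (forall x, U x -> mx_box L H (d_x h e x - B)) ->
  exists2 M, mx_box L H M & h (e, x) - h (e, x') = (x - x') *m (B + M).
Proof.
move=> segU dh bh; set w := x - x'.
have lineE (t : R) : (e, x' + t *: w) = (e, x') + t *: (0, w) :> R * 'rV[R]_k.
  by congr pair; rewrite /= scaler0 addr0.
have der (t : R) : 0 <= t <= 1 ->
    is_derive t 1 (fun t => h (e, x' + t *: w)) (w *m d_x h e (x' + t *: w)).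
  move=> t01; have dt := dh _ (segU _ t01).
  rewrite d_xE// -/w.
  rewrite (_ : (fun t => _) = fun t => h ((e, x') + t *: (0, w))); last first.
    by apply/funext => s; rewrite lineE.
  by rewrite -/w in dt *; rewrite lineE in dt *; exact: is_derive_line.
have mv j : exists t : R, 0 <= t <= 1 /\
    (h (e, x) - h (e, x')) 0 j = (w *m d_x h e (x' + t *: w)) 0 j.
  pose df (t : R) := (w *m d_x h e (x' + t *: w)) 0 j.
  have derj (t : R) : 0 <= t <= 1 ->
      is_derive t 1 (fun t => h (e, x' + t *: w) 0 j) (df t).
    move=> /der dt; have := is_derive_coord 0 j (@ex_derive _ _ _ _ _ _ _ dt).
    by rewrite derive1E derive_val.
  have [t|t|t /[!in_itv]/= t01] :=
      @MVT_segment R (fun t => h (e, x' + t *: w) 0 j) df 0 1 ler01.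
  - by rewrite in_itv/= => /andP[/ltW t0 /ltW t1]; apply: derj; rewrite t0.
  - apply: (@derivable_within_continuous _ _ (fun t => h (e, x' + t *: w) 0 j)).
    by move=> s; rewrite in_itv/= => /derj/@ex_derive.
  - rewrite scale1r scale0r addr0 [x' + w]addrC subrK subr0 mulr1 => hE.
    by exists t; split => //; rewrite -[RHS]/(df t) -hE !mxE.
have [xi xiP] := choice mv.
(* Column [j] is evaluated at the mean point [xi j] of coordinate [j]. *)
exists (\matrix_(i, j) (d_x h e (x' + xi j *: w) - B) i j).
  by move=> i j; rewrite mxE; apply: bh; apply: segU; have [] := xiP j.
apply/rowP => j; have [_ ->] := xiP j; rewrite !mxE.
by apply: eq_bigr => i _; congr (_ * _); rewrite !mxE [RHS]addrC subrK.
Qed.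

Lemma d_eps_derivable h e x : differentiable h (e, x) ->
  derivable (fun e => h (e, x)) e 1 /\ d_eps h e x = 'd h (e, x) (1, 0).
Proof.
move=> dh.
have lineE (t : R) : (t, x) = (0, x) + t *: (1, 0) :> R * 'rV[R]_k.
  by rewrite -[RHS]/(0 + t * 1, x + t *: 0) scaler0 addr0 mulr1 add0r.
have hE : (fun e => h (e, x)) = fun t : R => h ((0, x) + t *: (1, 0)).
  by apply/funext => t; rewrite -lineE.
have : is_derive e 1 (fun e => h (e, x)) ('d h (e, x) (1, 0)).
  rewrite hE; have dl := dh; rewrite (lineE e) in dl.
  by have := is_derive_line dl; rewrite -(lineE e).
move=> de; split; first exact: (@ex_derive _ _ _ _ _ _ _ de).
by rewrite /d_eps derive1E derive_val.
Qed.

(** Entry [(i, j)] of [d_x h] is coordinate [j] of the total derivative in the direction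
    [(0, delta_mx 0 i)]. The identity holds where [h] is differentiable, hence near [e] because [Om]
    is open. *)
Lemma derivable_d_x Om h e x : open Om -> twice_differentiable_on Om h ->
  Om (e, x) -> derivable (fun e => d_x h e x) e 1.
Proof.
move=> oOm d2h Omex; apply/derivable_mxP => i j.
pose f z := 'd h z (0, delta_mx 0 i) : 'rV[R]_l.
have df : derivable (fun t : R => f (t, x) 0 j) e 1.
  have [_ /(_ (0, delta_mx 0 i)) dfz] := d2h _ Omex.
  have [df _] := @d_eps_derivable f e x dfz.
  by move/derivable_mxP : df; exact.
apply: near_eq_derivable df.
have cx : {for e, continuous (fun t : R => (t, x))}.
  apply: differentiable_continuous.
  by apply: (@differentiable_pair _ R R 'rV[R]_k id (cst x)).
have : \forall t \near e, Om (t, x).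
  by apply: cx; exact: open_nbhs_nbhs.
apply: filterS => t /d2h[dt _].
by rewrite /f -d_xE// -rowE mxE.
Qed.

(** The norm of [d_eps h] is continuous on the compact interval, hence bounded there, so that the
    supremum in [set_norm] is an upper bound. *)
Lemma d_eps_le (N : 'rV[R]_l -> R) Om h (a : R) x : is_norm N ->
  twice_differentiable_on Om h ->
  `[0, a]%classic `*` [set x] `<=` Om ->
  forall e, 0 <= e <= a ->
  N (d_eps h e x) <= set_norm N [set d_eps h e x | e in `[0, a]%classic].
Proof.
move=> nN d2h sub e e0a.
have dE t : 0 <= t <= a -> d_eps h t x = 'd h (t, x) (1, 0).
  move=> ta; have [|dt _] := d2h (t, x); first by apply: sub; split.
  by have [] := d_eps_derivable dt.
have a0 : 0 <= a by case/andP: e0a => *; lra.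
pose f t := 'd h (t, x) (1, 0).
have [|c _ cmax] := @EVT_max R (N \o f) 0 a a0.
  apply/continuous_in_subspaceT => t; rewrite inE/= in_itv/= => ta.
  apply: continuous_comp; last exact: is_norm_continuous.
  have [|_ d2] := d2h (t, x); first by apply: sub; split.
  have [df _] := @d_eps_derivable (fun z => 'd h z (1, 0)) t x (d2 (1, 0)).
  by apply: differentiable_continuous; apply/derivable1_diffP.
apply: sup_upper_bound; last by exists (d_eps h e x) => //; exists e.
split; first by exists (N (d_eps h e x)), (d_eps h e x) => //; exists e.
exists ((N \o f) c) => _ [_ [t /= ta <-] <-]; rewrite in_itv/= in ta.
by rewrite (dE t ta); apply: (cmax t); rewrite in_itv.
Qed.

End PartialDerivativeFacts.

(** * The simplified Newton map *)

Lemma kernel_trivial_unitmx (F : fieldType) (n : nat) (A : 'M[F]_n) :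
  (forall v : 'rV[F]_n, v *m A = 0 -> v = 0) -> A \in unitmx.
Proof.
move=> A0; rewrite -row_free_unit -kermx_eq0.
apply/eqP/row_matrixP => i; rewrite row0; apply: A0.
by apply/sub_kermxP; exact: row_sub.
Qed.

Section NewtonZero.
Context {R : realType} {k1 k2 : nat}.
Variables (N1 : 'rV[R]_k1 -> R) (N2 : 'rV[R]_k2 -> R).
Hypotheses (nN1 : is_norm N1) (nN2 : is_norm N2).
Let N := max_norm N1 N2.

Let nN : is_norm N.
Proof. exact: max_norm_is_norm. Qed.

(** Here [(g1, g2)] is the system already multiplied by the approximate inverse derivative, so the
    Newton map is the identity minus [(g1, g2)]. The [c]s bound the first step from [p], the [q]s
    are Lipschitz constants of the two components. *)
Lemma newton_contraction_zero (p : 'rV[R]_(k1 + k2)) (r c1 c2 q1 q2 : R)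
    (g1 : 'rV[R]_(k1 + k2) -> 'rV[R]_k1) (g2 : 'rV[R]_(k1 + k2) -> 'rV[R]_k2) :
  0 <= c1 -> 0 <= c2 -> 0 <= q1 < 1 -> 0 <= q2 < 1 ->
  c1 + q1 * r < r -> c2 + q2 * r < r ->
  N1 (g1 p) <= c1 -> N2 (g2 p) <= c2 ->
  (forall x x', norm_ball N p r x -> norm_ball N p r x' ->
    N1 (lsubmx (x - x') - (g1 x - g1 x')) <= q1 * N (x - x')) ->
  (forall x x', norm_ball N p r x -> norm_ball N p r x' ->
    N2 (rsubmx (x - x') - (g2 x - g2 x')) <= q2 * N (x - x')) ->
  exists2 x, norm_ball N p r x & g1 x = 0 /\ g2 x = 0.
Proof.
move=> c10 c20 q1b q2b cr1 cr2 gp1 gp2 L1 L2.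
have [q10 q11] := andP q1b; have [q20 q21] := andP q2b.
(* The least radius with [c1 + q1 * r' <= r'] and [c2 + q2 * r' <= r']. It is below [r], so the
   closed ball of radius [r'] lies in the open ball where the estimates hold. *)
pose r' := Num.max (c1 / (1 - q1)) (c2 / (1 - q2)).
have r'1 : c1 + q1 * r' <= r'.
  have : c1 / (1 - q1) <= r' by rewrite le_max lexx.
  rewrite ler_pdivrMr ?subr_gt0//; lra.
have r'2 : c2 + q2 * r' <= r'.
  have : c2 / (1 - q2) <= r' by rewrite le_max lexx orbT.
  rewrite ler_pdivrMr ?subr_gt0//; lra.
have r'r : r' < r.
  by rewrite gt_max !ltr_pdivrMr ?subr_gt0//; apply/andP; split; lra.
have r'0 : 0 <= r' by rewrite le_max divr_ge0// subr_ge0 ltW.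
pose q := Num.max q1 q2.
pose F x := x - row_mx (g1 x) (g2 x).
have ballr x : N (x - p) <= r' -> norm_ball N p r x.
  by move=> /le_lt_trans; apply.
have ballp : norm_ball N p r p by apply: ballr; rewrite subrr is_norm0.
have FB x x' : F x - F x' =
    row_mx (lsubmx (x - x') - (g1 x - g1 x'))
      (rsubmx (x - x') - (g2 x - g2 x')).
  rewrite -[LHS]hsubmxK /F !linearB/= !row_mxKl !row_mxKr.
  by congr row_mx; rewrite addrACA.
have NF x x' : N (row_mx x x') = Num.max (N1 x) (N2 x').
  by rewrite /N /max_norm row_mxKl row_mxKr.
have Fp : F p - p = row_mx (- g1 p) (- g2 p).
  by rewrite /F addrAC subrr add0r opp_row_mx.
have [||x x' xr x'r|x xr Fx] := @contraction_fixpoint _ _ _ nN F p r' q r'0.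
- by rewrite le_max q10 gt_max q11.
(* Invariance of the closed ball, from [F x - p = (F x - F p) + (F p - p)]. *)
- move=> x xr; rewrite -(subrKA (F p)) FB Fp add_row_mx NF ge_max.
  have xb := ballr _ xr.
  apply/andP; split.
    rewrite (le_trans (is_normD nN1 _ _))// is_normN// (le_trans _ r'1)// addrC.
    by rewrite lerD// (le_trans (L1 _ _ xb ballp))// ler_wpM2l.
  rewrite (le_trans (is_normD nN2 _ _))// is_normN// (le_trans _ r'2)// addrC.
  by rewrite lerD// (le_trans (L2 _ _ xb ballp))// ler_wpM2l.
- rewrite FB NF ge_max; apply/andP; split.
    rewrite (le_trans (L1 _ _ (ballr _ xr) (ballr _ x'r)))//.
    by rewrite ler_wpM2r ?(is_norm_ge0 nN)// le_max lexx.
  rewrite (le_trans (L2 _ _ (ballr _ xr) (ballr _ x'r)))//.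
  by rewrite ler_wpM2r ?(is_norm_ge0 nN)// le_max lexx orbT.
- exists x; first exact: ballr.
  have : row_mx (g1 x) (g2 x) = 0.
    by move/eqP : Fx; rewrite /F -subr_eq0 addrAC subrr add0r oppr_eq0 => /eqP.
  by rewrite -row_mx0 => /eq_row_mx.
Qed.

(** A kernel vector [v] has components [- v M1 A1^-1] and [- v M2 A2^-1], of norm at most [q1 * N v]
    and [q2 * N v]. As [N v] is the larger of the two norms and both factors are below 1,
    [v = 0]. *)
Lemma block_perturbation_unitmx (q1 q2 : R)
    (A1 : 'M[R]_k1) (A2 : 'M[R]_k2) M1 M2 :
  0 <= q1 < 1 -> 0 <= q2 < 1 -> A1 \in unitmx -> A2 \in unitmx ->
  (forall v, N1 (v *m M1 *m invmx A1) <= q1 * N v) ->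
  (forall v, N2 (v *m M2 *m invmx A2) <= q2 * N v) ->
  row_mx (col_mx A1 0 + M1) (col_mx 0 A2 + M2) \in unitmx.
Proof.
move=> /andP[q10 q11] /andP[q20 q21] A1u A2u h1 h2.
apply: kernel_trivial_unitmx => v; rewrite mul_mx_row => vK.
have [e1 e2] := eq_row_mx (etrans vK (esym (row_mx0 _ _ _ _))).
have v1 : lsubmx v = - (v *m M1 *m invmx A1).
  move: e1; rewrite mulmxDr -{1}(hsubmxK v) mul_row_col mulmx0 addr0.
  by move/eqP; rewrite addr_eq0 => /eqP v1; rewrite -mulNmx -v1 mulmxK.
have v2 : rsubmx v = - (v *m M2 *m invmx A2).
  move: e2; rewrite mulmxDr -{1}(hsubmxK v) mul_row_col mulmx0 add0r.
  by move/eqP; rewrite addr_eq0 => /eqP v2; rewrite -mulNmx -v2 mulmxK.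
have := h1 v; have := h2 v; rewrite -(is_normN nN1) -v1 -(is_normN nN2) -v2.
move=> v2le v1le; apply: (is_norm_eq0 nN); apply/eqP.
have v0 := is_norm_ge0 nN v; rewrite eq_le v0 andbT leNgt; apply/negP => vgt.
have : N v < N v; last by rewrite ltxx.
rewrite {1}/N /max_norm gt_max (le_lt_trans v1le) ?(le_lt_trans v2le)//.
  by rewrite gtr_pMl.
by rewrite gtr_pMl.
Qed.

End NewtonZero.

Lemma norm_ball_convex (R : realType) (m : nat) (N : 'rV[R]_m -> R) p r
    (x x' : 'rV[R]_m) (t : R) :
  is_norm N -> norm_ball N p r x -> norm_ball N p r x' -> 0 <= t <= 1 ->
  norm_ball N p r (x' + t *: (x - x')).
Proof.
rewrite /norm_ball/= => nN xr x'r /andP[t0 t1].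
rewrite (_ : _ - p = t *: (x - p) + (1 - t) *: (x' - p)); last first.
  by apply/rowP => i; rewrite !mxE; ring.
rewrite (le_lt_trans (is_normD nN _ _))// !is_normZ//.
rewrite !ger0_norm ?subr_ge0//.
have mr : Num.max (N (x - p)) (N (x' - p)) < r by rewrite gt_max xr.
apply: le_lt_trans mr; set b := Num.max _ _.
rewrite [leRHS](_ : b = t * b + (1 - t) * b); last by ring.
by rewrite lerD// ler_wpM2l ?subr_ge0// le_max lexx ?orbT.
Qed.

(** The mean value inequality in the parameter, started at 0; it bounds the residuals of the Newton
    map at [p]. *)
Lemma norm_from_initial (R : realType) (k l : nat) (N : 'rV[R]_l -> R)
    (h : R * 'rV[R]_k -> 'rV[R]_l) (Om : set (R * 'rV[R]_k)) (a : R) x :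
  is_norm N -> twice_differentiable_on Om h ->
  `[0, a]%classic `*` [set x] `<=` Om -> h (0, x) = 0 ->
  forall e, 0 <= e <= a ->
  N (h (e, x)) <= e * set_norm N [set d_eps h e x | e in `[0, a]%classic].
Proof.
move=> nN d2h sub h0 e /andP[e0 ea].
rewrite -[h _]subr0 -h0 -{2}[e]subr0 mulrC.
apply: (is_norm_mean_value (h := fun e => h (e, x))) => // t /andP[t0 te].
  have [|dt _] := d2h (t, x); last by have [] := d_eps_derivable dt.
  by apply: sub; split => //=; rewrite in_itv/= t0 (le_trans te).
by apply: (d_eps_le nN d2h sub); rewrite t0 (le_trans te).
Qed.

(** As [U] is open, the function of [x] is locally constant. *)
Lemma d_x_vanish (R : realType) (k l : nat) (h : R * 'rV[R]_k -> 'rV[R]_l)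
    (U : set 'rV[R]_k) e x :
  open U -> differentiable h (e, x) -> (forall x, U x -> h (e, x) = 0) ->
  U x -> d_x h e x = 0.
Proof.
move=> oU dh h0 Ux; apply/row_matrixP => i; rewrite row0 rowE.
have dhx : differentiable (fun x' => h (e, x')) x.
  by apply: (@differentiable_comp _ _ _ _ (fun x' : 'rV[R]_k => (e, x')) h).
rewrite /d_x /jacobian mul_rV_lin1 /= -deriveE//.
rewrite (@near_eq_derive _ _ _ _ (cst 0)) ?derive_cst//.
have : \forall x' \near x, U x' by exact: open_nbhs_nbhs.
by apply: filterS => x' /h0.
Qed.

Lemma mx_box_scale (R : realType) (m n : nat) (a : R) (L H A : 'M[R]_(m, n)) :
  0 < a -> mx_box (a *: L) (a *: H) (a *: A) <-> mx_box L H A.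
Proof.
by move=> a0; split => h i j; have := h i j; rewrite !mxE !ler_pM2l.
Qed.

(** * Nondegenerate zeros for positive parameters *)

Section PerturbedZero.
Context {R : realType} {k1 k2 : nat}.
Variables (N1 : 'rV[R]_k1 -> R) (N2 : 'rV[R]_k2 -> R).
Variables (y1 : R * 'rV[R]_(k1 + k2) -> 'rV[R]_k1)
  (y2 : R * 'rV[R]_(k1 + k2) -> 'rV[R]_k2).
Variables (Om : set (R * 'rV[R]_(k1 + k2))) (U : set 'rV[R]_(k1 + k2)).
Variables (p : 'rV[R]_(k1 + k2)) (r a : R).
Variables (A11 : 'M[R]_k1) (A22 : 'M[R]_k2).
Variables (L1 H1 : 'M[R]_(k1 + k2, k1)) (L2 H2 : 'M[R]_(k1 + k2, k2)).
Let E := `[0, a]%classic.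
Let N := max_norm N1 N2.
Hypotheses (nN1 : is_norm N1) (nN2 : is_norm N2).
Hypotheses (oOm : open Om) (EUOm : E `*` U `<=` Om).
Hypotheses (dy1 : twice_differentiable_on Om y1)
  (dy2 : twice_differentiable_on Om y2).
Hypotheses (a0 : 0 < a) (r0 : 0 < r) (UE : U = norm_ball N p r).
Hypotheses (y1p : y1 (0, p) = 0) (y20 : forall x, U x -> y2 (0, x) = 0).
Hypothesis box1 :
  encloses L1 H1 [set d_x y1 z.1 z.2 - col_mx A11 0 | z in E `*` U].
Hypothesis box2 :
  encloses L2 H2 [set d_eps_x y2 z.1 z.2 - col_mx 0 A22 | z in E `*` U].
Hypothesis gt1 : (0 < k1)%N -> conorm N1 A11 * r >
  a * set_norm N1 [set d_eps y1 e p | e in E] +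
  set_norm (op_norm N N1) (mx_box L1 H1) * r.
Hypothesis gt2 : (0 < k2)%N -> conorm N2 A22 * r >
  set_norm N2 [set d_eps y2 e p | e in E] +
  set_norm (op_norm N N2) (mx_box L2 H2) * r.

Lemma perturbed_zero e : 0 < e <= a ->
  exists x, [/\ U x, y1 (e, x) = 0, y2 (e, x) = 0 &
    row_mx (d_x y1 e x) (d_x y2 e x) \in unitmx].
Proof.
move=> /andP[e0 ea].
have nN : is_norm N by exact: max_norm_is_norm.
have oU : open U by rewrite UE; exact: is_norm_open_ball.
have Up : U p by rewrite UE /norm_ball/= subrr (is_norm0 nN).
have Omt t x : 0 <= t <= a -> U x -> Om (t, x).
  by move=> ta Ux; apply: EUOm; split => //; rewrite /E/= in_itv.
have eE : 0 <= e <= a by rewrite ea ltW.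
have E0 : 0 <= (0 : R) <= a by rewrite lexx ltW.
have subp : E `*` [set p] `<=` Om.
  by move=> [t _] [/= ta ->]; apply: EUOm; split.
have diff1 t x : 0 <= t <= a -> U x -> differentiable y1 (t, x).
  by move=> ta Ux; have [] := dy1 (Omt _ _ ta Ux).
have diff2 t x : 0 <= t <= a -> U x -> differentiable y2 (t, x).
  by move=> ta Ux; have [] := dy2 (Omt _ _ ta Ux).
have b1 x : U x -> mx_box L1 H1 (d_x y1 e x - col_mx A11 0).
  by move=> Ux; apply: box1; exists (e, x).
(* Since [d_x y2] vanishes at parameter 0, dividing it by [e] gives a difference quotient in the
   parameter, which the enclosure of the mixed derivative controls. *)
have b2 x : U x -> mx_box L2 H2 (e^-1 *: d_x y2 e x - col_mx 0 A22).
  move=> Ux; rewrite -[d_x y2 e x]subr0.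
  rewrite -(d_x_vanish oU (diff2 _ _ E0 Ux) y20 Ux).
  apply: (difference_quotient_box (G := fun t => d_x y2 t x))
    => // t /andP[t0 te].
    by apply: (derivable_d_x oOm dy2); apply: Omt; rewrite // t0 (le_trans te).
  apply: box2; exists (t, x) => //; split => //=.
  by rewrite /E/= in_itv/= t0 (le_trans te).
have S1 : 0 <= set_norm N1 [set d_eps y1 e p | e in E].
  by apply: le_trans (is_norm_ge0 nN1 _) (d_eps_le nN1 dy1 subp E0).
have S2 : 0 <= set_norm N2 [set d_eps y2 e p | e in E].
  by apply: le_trans (is_norm_ge0 nN2 _) (d_eps_le nN2 dy2 subp E0).
have [|c1 [q1 [[c10 q1b cr1 C1 M1] A1u]]] :=
    conorm_gt nN1 nN r0 (mulr_ge0 (ltW a0) S1) _ gt1.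
  by exists (d_x y1 e p - col_mx A11 0); exact: b1.
have [|c2 [q2 [[c20 q2b cr2 C2 M2] A2u]]] := conorm_gt nN2 nN r0 S2 _ gt2.
  by exists (e^-1 *: d_x y2 e p - col_mx 0 A22); exact: b2.
(* The rescaled system [(y1, e^-1 y2)], multiplied by the inverse of [diag(A11, A22)]. *)
pose g1 x := y1 (e, x) *m invmx A11.
pose g2 x := (e^-1 *: y2 (e, x)) *m invmx A22.
have segU x x' : U x -> U x' ->
    forall t : R, 0 <= t <= 1 -> U (x' + t *: (x - x')).
  by rewrite UE => Ux Ux' t; exact: norm_ball_convex.
have en0 : e != 0 by rewrite gt_eqF.
have [||x x' Ux Ux'|x x' Ux Ux'|x Ux [g1x g2x]] := @newton_contraction_zero
    _ _ _ _ _ nN1 nN2 p r c1 c2 q1 q2 g1 g2 c10 c20 q1b q2b cr1 cr2.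
- apply: C1; apply: le_trans (norm_from_initial nN1 dy1 subp y1p eE) _.
  by rewrite ler_wpM2r.
(* The division by [e] cancels the factor [e] of the mean value bound; this is why the parameter
   length enters the first inequality only. *)
- apply: C2; rewrite is_normZ// gtr0_norm ?invr_gt0// ler_pdivrMl//.
  exact: (norm_from_initial nN2 dy2 subp (y20 Up) eE).
- rewrite -/N -UE in Ux Ux'.
  have [M bM yM] := mean_value_box (segU _ _ Ux Ux') (fun x => diff1 e x eE) b1.
  rewrite -mulmxBl yM mulmxDr -[X in X *m col_mx _ _]hsubmxK mul_row_col.
  rewrite mulmx0 addr0 mulmxDl mulmxK// opprD addNKr (is_normN nN1).
  exact: M1.
- rewrite -/N -UE in Ux Ux'.
  (* The spatial mean value theorem is applied to [y2] itself, so the box is scaled by [e]; the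
     scaling is undone before [M2] is used. *)
  have b2e x0 : U x0 ->
      mx_box (e *: L2) (e *: H2) (d_x y2 e x0 - e *: col_mx 0 A22).
    move=> Ux0; rewrite -[d_x _ _ _](scalerKV en0).
    rewrite -scalerBr; apply/mx_box_scale => //; exact: b2.
  have [M bM yM] :=
    mean_value_box (segU _ _ Ux Ux') (fun x => diff2 e x eE) b2e.
  rewrite -mulmxBl -scalerBr yM scalemxAr scalerDr scalerA mulVf// scale1r.
  rewrite mulmxDr -[X in X *m col_mx _ _]hsubmxK mul_row_col.
  rewrite mulmx0 add0r mulmxDl mulmxK// opprD addNKr (is_normN nN2).
  by apply: M2; apply/(mx_box_scale _ _ _ e0); rewrite scalerA mulfV// scale1r.
- rewrite -/N -UE in Ux; exists x; split => //.
  + by rewrite -(mulmxKV A1u (y1 _)) -/(g1 x) g1x mul0mx.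
  + apply: (scalerI (invr_neq0 en0)).
    by rewrite scaler0 -(mulmxKV A2u (_ *: _)) -/(g2 x) g2x mul0mx.
  + have eu : e \is a GRing.unit by rewrite unitfE.
    have eA2u : e *: A22 \in unitmx by rewrite unitmxZ.
    (* The derivative at the zero is a perturbation of [diag(A11, e A22)]. In the second block the
       factor [e] moves from the inverse to the perturbation, which is then bounded by [b2]. *)
    rewrite -(subrKC (col_mx A11 0) (d_x y1 e x)).
    rewrite -(subrKC (col_mx 0 (e *: A22)) (d_x y2 e x)).
    apply: (block_perturbation_unitmx nN1 nN2 q1b q2b) => // v.
      by apply: M1; exact: b1.
    rewrite invmxZ// -scalemxAr scalemxAl scalemxAr scalerBr scale_col_mx.
    by rewrite scaler0 scalerK//; apply: M2; exact: b2.
Qed.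

End PerturbedZero.

(** * Twice differentiable maps *)

Section TwiceDifferentiable.
Context {R : realType}.
Implicit Types V W : normedModType R.

(** Both functions have the same first-order expansion at [x], and differentials are unique. This
    transfers differentiability from formulas valid only on an open set. *)
Lemma near_eq_differentiable V W (f g : V -> W) x :
  (\forall z \near x, f z = g z) -> differentiable f x ->
  differentiable g x /\ 'd g x = 'd f x :> (V -> W).
Proof.
move=> fg df; have [dfc dfE] := (diff_locallyP _ _).1 df.
have gE : g \o shift x = cst (g x) + 'd f x +o_ 0 id.
  have fgx : f x = g x := nbhs_singleton fg.
  rewrite -fgx; apply/eqaddoP => eps eps0.
  have /eqaddoP/(_ eps eps0) := dfE.
  have fg0 : \forall z \near (0 : V), f (z + x) = g (z + x).
    move: fg; rewrite (near_shift 0 x)/=.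
    by apply: filterS => z; rewrite /= subr0.
  apply: filter_app; near=> z => /=.
  rewrite !fctE/=; have -> // : f (z + x) = g (z + x).
  by near: z.
have dE : 'd g x = 'd f x :> (V -> W) by apply: diff_unique.
split; last exact: dE.
by apply/diff_locallyP; rewrite dE; split.
Unshelve. all: by end_near. Qed.

Lemma differentiable_big V W (I : finType) (F : I -> V -> W) x :
  (forall i, differentiable (F i) x) ->
  differentiable (fun z => \sum_i F i z) x.
Proof.
move=> dF; rewrite (_ : (fun z => _) = \sum_i F i); last first.
  by apply/funext => z; rewrite fct_sumE.
elim/big_ind : _ => [|f g df dg|i _].
- by have := @differentiable_cst R V W 0 x.
- exact: differentiableD.
- exact: dF.
Qed.

(** Expanding [F] in the standard basis reduces this to products of scalar functions. *)
Lemma differentiable_scale V m (a : V -> R) (F : V -> 'rV[R]_m) x :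
  differentiable a x -> differentiable F x ->
  differentiable (fun z => a z *: F z) x.
Proof.
move=> da dF.
rewrite (_ : (fun z => _) = fun z => \sum_j (a z * F z 0 j) *: delta_mx 0 j).
  apply: differentiable_big => j; apply: differentiableZl.
  apply: (@differentiableM _ _ a (fun z => F z 0 j)) => //.
  apply: (@differentiable_comp _ _ _ _ F (fun M : 'rV[R]_m => M 0 j : R)) => //.
  exact: differentiable_coord.
apply/funext => z; rewrite {1}[F z]row_sum_delta scaler_sumr.
by apply: eq_bigr => j _; rewrite scalerA.
Qed.

Lemma class_C_twice_differentiable V W (Om : set V) (g : V -> W) :
  class_C 2 Om g -> twice_differentiable_on Om g.
Proof.
move=> [dg d2g] z Oz; split=> [|v]; first exact: dg.
by have [+ _] := d2g v; exact.
Qed.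

Lemma twice_differentiable_subset V W (Om Om' : set V) (g : V -> W) :
  Om' `<=` Om -> twice_differentiable_on Om g -> twice_differentiable_on Om' g.
Proof. by move=> sub d2g z /sub/d2g. Qed.

(** In the chain rule ['d f (g z) ('d g z v)] the direction varies with [z], whereas the hypothesis
    on [f] concerns fixed directions. Expanding the direction over the [b i], with coordinates
    [c i], separates the two dependences. *)
Lemma twice_differentiable_comp V W m (I : finType) (b : I -> W)
    (c : I -> W -> R) (Om : set V) (Om' : set W) (g : V -> W)
    (f : W -> 'rV[R]_m) :
  (forall w, w = \sum_i c i w *: b i) -> (forall i w, differentiable (c i) w) ->
  open Om -> open Om' -> twice_differentiable_on Om g ->
  twice_differentiable_on Om' f ->
  open (Om `&` g @^-1` Om') /\
  twice_differentiable_on (Om `&` g @^-1` Om') (f \o g).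
Proof.
move=> cb dc oOm oOm' d2g d2f.
have oI : open (Om `&` g @^-1` Om').
  rewrite openE => z [Oz Ogz]; apply: filterI; first exact: open_nbhs_nbhs.
  have [dg _] := d2g _ Oz; apply: (differentiable_continuous dg).
  exact: open_nbhs_nbhs.
split => // z Iz; have [Oz Ogz] := Iz.
have [dg d2gz] := d2g _ Oz; have [df d2fz] := d2f _ Ogz.
split=> [|v]; first exact: differentiable_comp.
have dsum : differentiable
    (fun z => \sum_i c i ('d g z v) *: 'd f (g z) (b i)) z.
  apply: differentiable_big => i; apply: differentiable_scale.
    exact: (@differentiable_comp _ _ _ _ (fun z => 'd g z v) (c i)).
  exact: (@differentiable_comp _ _ _ _ g (fun w => 'd f w (b i))).
apply: (near_eq_differentiable _ dsum).1.
have : \forall z' \near z, (Om `&` g @^-1` Om') z' by exact: open_nbhs_nbhs.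
apply: filterS => z' [Oz' Ogz'].
have [dg' _] := d2g _ Oz'; have [df' _] := d2f _ Ogz'.
have -> : 'd (f \o g) z' v = 'd f (g z') ('d g z' v) by rewrite diff_comp.
rewrite [in RHS](cb ('d g z' v)) linear_sum.
by apply: eq_bigr => i _; rewrite linearZ.
Qed.

Lemma diff_linear_comp V W W' (L : {linear W -> W'}) (g : V -> W) z :
  continuous L -> differentiable g z ->
  differentiable (L \o g) z /\ 'd (L \o g) z = L \o 'd g z :> (V -> W').
Proof.
move=> cL dg; have dL := @linear_differentiable _ _ _ L (g z) cL.
split; first exact: differentiable_comp.
by rewrite diff_comp// diff_lin.
Qed.

Lemma twice_differentiable_linear V W W' (Om : set V) (L : {linear W -> W'})
    (g : V -> W) : open Om -> continuous L ->
  twice_differentiable_on Om g -> twice_differentiable_on Om (L \o g).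
Proof.
move=> oOm cL d2g z Oz; have [dg d2gz] := d2g _ Oz.
split=> [|v]; first by have [] := diff_linear_comp cL dg.
have [dLg _] := diff_linear_comp cL (d2gz v).
apply: (near_eq_differentiable _ dLg).1.
have : \forall z' \near z, Om z' by exact: open_nbhs_nbhs.
apply: filterS => z' /d2g[dg' _].
by have [_ ->] := diff_linear_comp cL dg'.
Qed.

Lemma twice_differentiableB V W (Om : set V) (f g : V -> W) : open Om ->
  twice_differentiable_on Om f -> twice_differentiable_on Om g ->
  twice_differentiable_on Om (f - g).
Proof.
move=> oOm d2f d2g z Oz; have [df d2fz] := d2f _ Oz; have [dg d2gz] := d2g _ Oz.
split=> [|v]; first exact: differentiableB.
apply: (near_eq_differentiable _ (differentiableB (d2fz v) (d2gz v))).1.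
have : \forall z' \near z, Om z' by exact: open_nbhs_nbhs.
apply: filterS => z' Oz'; have [df' _] := d2f _ Oz'; have [dg' _] := d2g _ Oz'.
by rewrite diffB.
Qed.

Lemma differentiable_fst V W (z : V * W) :
  differentiable (fst : V * W -> V) z /\
  'd (fst : V * W -> V) z = fst :> (_ -> _).
Proof.
have cf : continuous (fst : V * W -> V) by move=> x; exact: cvg_fst.
by split; [exact: linear_differentiable|exact: diff_lin].
Qed.

Lemma differentiable_snd V W (z : V * W) :
  differentiable (snd : V * W -> W) z /\
  'd (snd : V * W -> W) z = snd :> (_ -> _).
Proof.
have cf : continuous (snd : V * W -> W) by move=> x; exact: cvg_snd.
by split; [exact: linear_differentiable|exact: diff_lin].
Qed.

Lemma twice_differentiable_pair_fst k m (Om : set (R * 'rV[R]_k))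
    (g : R * 'rV[R]_k -> 'rV[R]_m) : open Om ->
  twice_differentiable_on Om g ->
  twice_differentiable_on Om (fun z => (z.1, g z)).
Proof.
move=> oOm d2g z Oz; have [dg d2gz] := d2g _ Oz.
have d1 w := (@differentiable_fst R 'rV[R]_k w).1.
split=> [|v]; first exact: differentiable_pair.
have dp : differentiable (fun z => (v.1, 'd g z v)) z.
  exact: (@differentiable_pair _ _ _ _ (cst v.1)).
apply: (near_eq_differentiable _ dp).1.
have : \forall z' \near z, Om z' by exact: open_nbhs_nbhs.
apply: filterS => z' /d2g[dg' _].
rewrite (@diff_pair _ _ _ _ fst g)//.
by have [_ ->] := @differentiable_fst R 'rV[R]_k z'.
Qed.

Lemma twice_differentiable_comp_rV k m l (Om : set (R * 'rV[R]_k))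
    (Om' : set 'rV[R]_m) (g : R * 'rV[R]_k -> 'rV[R]_m)
    (f : 'rV[R]_m -> 'rV[R]_l) :
  open Om -> open Om' -> twice_differentiable_on Om g ->
  twice_differentiable_on Om' f ->
  open (Om `&` g @^-1` Om') /\
  twice_differentiable_on (Om `&` g @^-1` Om') (f \o g).
Proof.
apply: (twice_differentiable_comp (b := fun i => delta_mx 0 i)
  (c := fun i (w : 'rV[R]_m) => w 0 i)) => [w|i w].
  exact: row_sum_delta.
exact: differentiable_coord.
Qed.

Lemma twice_differentiable_comp_pair k m l (Om : set (R * 'rV[R]_k))
    (Om' : set (R * 'rV[R]_m)) (g : R * 'rV[R]_k -> R * 'rV[R]_m)
    (f : R * 'rV[R]_m -> 'rV[R]_l) :
  open Om -> open Om' -> twice_differentiable_on Om g ->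
  twice_differentiable_on Om' f ->
  open (Om `&` g @^-1` Om') /\
  twice_differentiable_on (Om `&` g @^-1` Om') (f \o g).
Proof.
(* Index 0 is the parameter direction; the others are the standard basis of the row vectors. *)
pose b (i : 'I_m.+1) : R * 'rV[R]_m :=
  if unlift ord0 i is Some i then (0, delta_mx 0 i) else (1, 0).
pose c (i : 'I_m.+1) (w : R * 'rV[R]_m) : R :=
  if unlift ord0 i is Some i then w.2 0 i else w.1.
apply: (twice_differentiable_comp (b := b) (c := c)) => [[t w]|i w].
- rewrite big_ord_recl /b /c unlift_none/=.
  rewrite -[X in X + _]/(t * 1, t *: 0) mulr1 scaler0.
  rewrite (eq_bigr (fun i => (0, w 0 i *: delta_mx 0 i))); last first.
    move=> i _; rewrite liftK.
    by rewrite -[LHS]/(w 0 i * 0, w 0 i *: delta_mx 0 i) mulr0.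
  suff -> : \sum_i ((0, w 0 i *: delta_mx 0 i) : R * 'rV[R]_m) = (0, w).
    by rewrite -[RHS]/(t + 0, 0 + w) addr0 add0r.
  rewrite {2}[w]row_sum_delta.
  elim/big_ind2 : _ => // u1 v1 u2 v2 -> ->.
  by rewrite -[LHS]/(0 + 0, u1 + u2) addr0.
- rewrite /c; case: unliftP => [i' _|_]; last exact: (differentiable_fst _).1.
  apply: (@differentiable_comp _ _ _ _ snd (fun M : 'rV[R]_m => M 0 i' : R)).
    exact: (differentiable_snd _).1.
  exact: differentiable_coord.
Qed.

End TwiceDifferentiable.

(** * Transversality of graphs *)

Section Transversality.
Context {R : realType} {k : nat}.
Implicit Types (c a b : 'rV[R]_k -> 'rV[R]_(k + k)).

(** Near [x] the map [w \o u] equals [c \o (h \o u)], with [h] the change of parameters, so its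
    differential factors through the Jacobian of [c]. *)
Lemma tangent_space_diff c (D U : set 'rV[R]_k) (w : 'rV[R]_k -> 'rV[R]_(k + k))
    (u : 'rV[R]_k -> 'rV[R]_k) x v :
  class_C 1 setT c -> parameterises c D w -> open U -> U x ->
  (forall x', U x' -> D (u x')) -> differentiable u x ->
  range c (w (u x)) /\ tangent_space c (w (u x)) ('d (w \o u) x v).
Proof.
move=> [dc _] [h [[dh _] _ _ wE]] oU Ux uD du; rewrite wE; last exact: uD.
split; first by exists (h (u x)).
exists (h (u x)) => //; exists ('d (h \o u) x v).
have dhu : differentiable (h \o u) x.
  by apply: differentiable_comp => //; apply: dh; exact: uD.
have dch : differentiable c ((h \o u) x) by exact: dc.
have near_w : \forall x' \near x, (c \o (h \o u)) x' = (w \o u) x'.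
  have : \forall x' \near x, U x' by exact: open_nbhs_nbhs.
  by apply: filterS => x' Ux'; rewrite /= wE//; exact: uD.
have [_ ->] := near_eq_differentiable near_w (differentiable_comp dhu dch).
by rewrite diff_comp//= /jacobian mul_rV_lin1.
Qed.

(* In the coordinates psi = (x, y) both manifolds are graphs over x, with slopes
   Qa and Qb; they are transversal as soon as Qa - Qb is invertible. *)
Lemma transversal_at_graphs c1 c2 a b (psi : 'rV[R]_(k + k) -> 'rV[R]_(k + k))
    x q (Qa Qb : 'M[R]_k) :
  range c1 q -> range c2 q -> 'J psi q \in unitmx ->
  (forall v, tangent_space c1 q ('d a x v)) ->
  (forall v, tangent_space c2 q ('d b x v)) ->
  (forall v, 'd a x v *m 'J psi q = row_mx v (v *m Qa)) ->
  (forall v, 'd b x v *m 'J psi q = row_mx v (v *m Qb)) ->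
  Qa - Qb \in unitmx -> transversal_at c1 c2 q.
Proof.
move=> c1q c2q Ju ta tb aE bE Qu; split => // v.
pose al := lsubmx (v *m 'J psi q); pose be := rsubmx (v *m 'J psi q).
(* In coordinates [v] is [(al, be)]. The sum of graph vectors over [w1] and [al - w1] has second
   part [w1 Qa + (al - w1) Qb]; equating this to [be] and solving gives [w1]. *)
pose w1 := (be - al *m Qb) *m invmx (Qa - Qb).
exists ('d a x w1), ('d b x (al - w1)); split; [exact: ta|exact: tb|].
rewrite -[LHS](mulmxK Ju) -[RHS](mulmxK Ju); congr mulmx.
rewrite mulmxDl aE bE add_row_mx subrKC mulmxBl addrCA -mulmxBr mulmxKV//.
by rewrite subrKC hsubmxK.
Qed.

(** The map [a] is a section of the [x]-projection over the open set [U], so the first block of the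
    derivative is the identity. *)
Lemma graph_jacobian a (psi : 'rV[R]_(k + k) -> 'rV[R]_(k + k))
    (U : set 'rV[R]_k) x v :
  open U -> U x -> differentiable a x -> differentiable psi (a x) ->
  (forall x', U x' -> pi_x psi (a x') = x') ->
  'd a x v *m 'J psi (a x) = row_mx v (v *m 'J (pi_y psi \o a) x).
Proof.
move=> oU Ux da dpsi aE; rewrite /jacobian !mul_rV_lin1/=.
have dpa : differentiable (psi \o a) x by exact: differentiable_comp.
have -> : 'd psi (a x) ('d a x v) = 'd (psi \o a) x v.
  exact: (esym (congr1 (fun f => f v) (diff_comp da dpsi))).
have [_ ry] := diff_linear_comp (L := rsubmx) (@continuous_rsubmx R 1 k k) dpa.
have [dx lx] := diff_linear_comp (L := lsubmx) (@continuous_lsubmx R 1 k k) dpa.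
rewrite -[LHS]hsubmxK; congr row_mx.
  have -> : lsubmx ('d (psi \o a) x v) = 'd (lsubmx \o (psi \o a)) x v.
    by rewrite lx.
  have near_id : \forall x' \near x, (lsubmx \o (psi \o a)) x' = x'.
    have : \forall x' \near x, U x' by exact: open_nbhs_nbhs.
    by apply: filterS => x' /aE.
  have [_ <-] := near_eq_differentiable near_id dx.
  by have := @diff_val _ _ _ _ _ _ _ (is_diff_id x) => /= ->.
by have -> : pi_y psi \o a = rsubmx \o (psi \o a) by []; rewrite ry.
Qed.

(** Serves for each of the two terms of [gap]. Every composition shrinks the open domain to a
    preimage, and the conditions on [D] keep [D] inside. *)
Lemma chart_twice_differentiable {m n : nat} (Ou : set (R * 'rV[R]_k))
    (Ow : set (R * 'rV[R]_m)) (Op : set 'rV[R]_(n + n))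
    (u : R * 'rV[R]_k -> 'rV[R]_m) (w : R * 'rV[R]_m -> 'rV[R]_(n + n))
    (psi : 'rV[R]_(n + n) -> 'rV[R]_(n + n)) (D : set (R * 'rV[R]_k)) :
  open Ou -> open Ow -> open Op -> class_C 2 Ou u -> class_C 2 Ow w ->
  class_C 2 Op psi ->
  D `<=` Ou -> (forall z, D z -> Ow (z.1, u z)) ->
  (forall z, D z -> Op (w (z.1, u z))) ->
  exists Om, [/\ open Om, D `<=` Om &
    twice_differentiable_on Om (fun z => pi_y psi (w (z.1, u z)))].
Proof.
move=> oOu oOw oOp /class_C_twice_differentiable du.
move=> /class_C_twice_differentiable dw /class_C_twice_differentiable dpsi.
move=> DOu DOw DOp.
have dp := twice_differentiable_pair_fst oOu du.
have [op1 d1] := twice_differentiable_comp_pair oOu oOw dp dw.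
have [op2 d2] := twice_differentiable_comp_rV op1 oOp d1 dpsi.
have := twice_differentiable_linear (L := rsubmx) op2
  (@continuous_rsubmx R 1 n n) d2.
set Om := (X in twice_differentiable_on X) => d3.
exists Om; split => //.
by move=> z Dz; split; [split; [exact: DOu|exact: DOw]|exact: DOp].
Qed.

End Transversality.

(** * Derivative of the gap function and the transversal intersection *)

Lemma row_mx_d_x (R : realType) (k k1 k2 : nat)
    (y : R * 'rV[R]_k -> 'rV[R]_(k1 + k2)) e x :
  differentiable (fun x => y (e, x)) x ->
  row_mx (d_x (fun z => lsubmx (y z)) e x) (d_x (fun z => rsubmx (y z)) e x) =
  d_x y e x.
Proof.
move=> dy; apply/row_matrixP => i; rewrite !rowE mul_mx_row /d_x /jacobian.
rewrite !mul_rV_lin1/=.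
have [_ lE] := diff_linear_comp (L := lsubmx) (@continuous_lsubmx R 1 k1 k2) dy.
have [_ rE] := diff_linear_comp (L := rsubmx) (@continuous_rsubmx R 1 k1 k2) dy.
rewrite -[fun x' => lsubmx _]/(lsubmx \o (fun x => y (e, x))) lE.
rewrite -[fun x' => rsubmx _]/(rsubmx \o (fun x => y (e, x))) rE.
exact: hsubmxK.
Qed.

Lemma jacobianB (R : realType) (m n : nat) (f g : 'rV[R]_m -> 'rV[R]_n) x :
  differentiable f x -> differentiable g x ->
  'J (f - g) x = 'J f x - 'J g x.
Proof.
move=> df dg; apply/row_matrixP => i; rewrite !rowE mulmxBr.
have JE (h : 'rV[R]_m -> 'rV[R]_n) :
    delta_mx 0 i *m 'J h x = 'd h x (delta_mx 0 i) := mul_rV_lin1 _ _.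
apply: etrans (JE (f - g)) _.
apply: etrans (congr1 (fun h => h (delta_mx 0 i)) (diffB df dg)) _.
exact: esym (congr2 (fun v w => v - w) (JE f) (JE g)).
Qed.

Unset Implicit Arguments.
Set Strict Implicit.
Set Printing Implicit Defensive.

Theorem theorem10 (R : realType) (k1 k2 : nat)
    (* the family of ODEs, its flow and its fixed points *)
    (eps0 : R) (E : set R)
    (f : R * 'rV[R]_((k1 + k2) + (k1 + k2)) ->
         'rV[R]_((k1 + k2) + (k1 + k2)))
    (T : R -> 'rV[R]_((k1 + k2) + (k1 + k2)) -> set R)
    (Phi : R -> R -> 'rV[R]_((k1 + k2) + (k1 + k2)) ->
           'rV[R]_((k1 + k2) + (k1 + k2)))
    (lam : R -> 'rV[R]_((k1 + k2) + (k1 + k2)))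
    (* the unstable and stable manifolds and their local parameterisations *)
    (cu cs : R -> 'rV[R]_(k1 + k2) -> 'rV[R]_((k1 + k2) + (k1 + k2)))
    (wu ws : R * 'rV[R]_(k1 + k2) -> 'rV[R]_((k1 + k2) + (k1 + k2)))
    (* the local coordinates *)
    (O : set 'rV[R]_((k1 + k2) + (k1 + k2)))
    (psi : 'rV[R]_((k1 + k2) + (k1 + k2)) ->
           'rV[R]_((k1 + k2) + (k1 + k2)))
    (U' S' U : set 'rV[R]_(k1 + k2))
    (u s : R * 'rV[R]_(k1 + k2) -> 'rV[R]_(k1 + k2))
    (* end points of the interval enclosures *)
    (Lu Hu Ls Hs : 'M[R]_(k1 + k2))
    (L1 H1 : 'M[R]_(k1 + k2, k1)) (L2 H2 : 'M[R]_(k1 + k2, k2))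
    (N1 : 'rV[R]_k1 -> R) (N2 : 'rV[R]_k2 -> R)
    (p : 'rV[R]_(k1 + k2)) (r : R)
    (y := gap psi wu ws u s)
    (y1 := fun z => lsubmx (y z) : 'rV[R]_k1)
    (y2 := fun z => rsubmx (y z) : 'rV[R]_k2)
    (A11 := usubmx (d_x y1 0 p) : 'M[R]_k1)
    (A22 := dsubmx (d_eps_x y2 0 p) : 'M[R]_k2) :
  0 < eps0 -> E = `[0, eps0]%classic ->
  smooth_on (E `*` setT) f ->
  (forall e, E e -> is_flow (fun q => f (e, q)) (T e) (Phi e)) ->
  (forall e, E e -> hyperbolic_fixed_point (fun q => f (e, q)) (lam e)) ->
  (forall e, E e ->
     immersed_manifold (unstable_set (T e) (Phi e) (lam e)) (cu e)) ->
  (forall e, E e ->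
     immersed_manifold (stable_set (T e) (Phi e) (lam e)) (cs e)) ->
  class_C_on 2 (E `*` unit_ball) wu ->
  class_C_on 2 (E `*` unit_ball) ws ->
  (forall e, E e -> parameterises (cu e) unit_ball (fun a => wu (e, a))) ->
  (forall e, E e -> parameterises (cs e) unit_ball (fun a => ws (e, a))) ->
  local_coordinates O psi ->
  open U' -> bounded_set U' -> closure U' `<=` unit_ball ->
  open S' -> bounded_set S' -> closure S' `<=` unit_ball ->
  (forall e a, E e -> closure U' a -> O (wu (e, a))) ->
  (forall e a, E e -> closure S' a -> O (ws (e, a))) ->
  encloses Lu Hu [set d_x (pi_x psi \o wu) z.1 z.2 | z in E `*` closure U'] ->
  (forall A, mx_box Lu Hu A -> A \in unitmx) ->
  encloses Ls Hs [set d_x (pi_x psi \o ws) z.1 z.2 | z in E `*` closure S'] ->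
  (forall A, mx_box Ls Hs A -> A \in unitmx) ->
  open U ->
  U `<=` ((pi_x psi \o wu) @` (E `*` U')) `&`
         ((pi_x psi \o ws) @` (E `*` S')) ->
  class_C_on 2 (E `*` U) u -> class_C_on 2 (E `*` U) s ->
  (forall e x, E e -> U x -> U' (u (e, x))) ->
  (forall e x, E e -> U x -> S' (s (e, x))) ->
  (forall e x, E e -> U x -> pi_x psi (wu (e, u (e, x))) = x) ->
  (forall e x, E e -> U x -> pi_x psi (ws (e, s (e, x))) = x) ->
  is_norm N1 -> is_norm N2 ->
  0 < r -> U = norm_ball (max_norm N1 N2) p r ->
  y (0, p) = 0 ->
  (forall x, U x -> y2 (0, x) = 0) ->
  encloses L1 H1 [set d_x y1 z.1 z.2 - col_mx A11 0 | z in E `*` U] ->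
  encloses L2 H2 [set d_eps_x y2 z.1 z.2 - col_mx 0 A22 | z in E `*` U] ->
  ((0 < k1)%N ->
     conorm N1 A11 * r >
       eps0 * set_norm N1 [set d_eps y1 e p | e in E] +
       set_norm (op_norm (max_norm N1 N2) N1) (mx_box L1 H1) * r) ->
  ((0 < k2)%N ->
     conorm N2 A22 * r >
       set_norm N2 [set d_eps y2 e p | e in E] +
       set_norm (op_norm (max_norm N1 N2) N2) (mx_box L2 H2) * r) ->
  forall e, 0 < e <= eps0 ->
    exists q, [/\ [set wu (e, a) | a in U'] q, [set ws (e, a) | a in S'] q &
                  transversal_at (cu e) (cs e) q].
Proof.
move=> eps0_gt0 EE _ _ _ cuM csM [Owu [oOwu subwu dwu]] [Ows [oOws subws dws]].
move=> wuP wsP [oO dpsi psiI psiJ] _ _ clU' _ _ clS' wuO wsO _ _ _ _ oU _.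
move=> [Ou [oOu subu du]] [Os [oOs subs ds]] uU' sS' uE sE nN1 nN2 r0 UE.
move=> yp y20 box1 box2 gt1 gt2 e /andP[e0 ee].
have uB t x : E t -> U x -> unit_ball (u (t, x)).
  by move=> Et Ux; apply/clU'/subset_closure/uU'.
have sB t x : E t -> U x -> unit_ball (s (t, x)).
  by move=> Et Ux; apply/clS'/subset_closure/sS'.
have uO t x : E t -> U x -> O (wu (t, u (t, x))).
  by move=> Et Ux; apply/wuO => //; apply/subset_closure/uU'.
have sO t x : E t -> U x -> O (ws (t, s (t, x))).
  by move=> Et Ux; apply/wsO => //; apply/subset_closure/sS'.
have [|[t x] [Et Ux]|Omu [oOmu subOmu dOmu]] :=
    chart_twice_differentiable oOu oOwu oO du dwu dpsi subu.
- by move=> [t x] [Et Ux]; apply: subwu; split => //; exact: uB.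
- exact: uO.
have [|[t x] [Et Ux]|Oms [oOms subOms dOms]] :=
    chart_twice_differentiable oOs oOws oO ds dws dpsi subs.
- by move=> [t x] [Et Ux]; apply: subws; split => //; exact: sB.
- exact: sO.
pose Om := Omu `&` Oms.
have oOm : open Om by exact: openI.
have subOm : E `*` U `<=` Om.
  by move=> z Dz; split; [exact: subOmu|exact: subOms].
have dy : twice_differentiable_on Om y.
  apply: twice_differentiableB => //.
    by apply: twice_differentiable_subset dOmu => z [].
  by apply: twice_differentiable_subset dOms => z [].
have dy1 : twice_differentiable_on Om y1.
  exact: (twice_differentiable_linear (L := lsubmx) oOm
    (@continuous_lsubmx R 1 k1 k2) dy).
have dy2 : twice_differentiable_on Om y2.
  exact: (twice_differentiable_linear (L := rsubmx) oOm
    (@continuous_rsubmx R 1 k1 k2) dy).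
have y1p : y1 (0, p) = 0 by rewrite /y1 yp linear0.
move: box1 box2 gt1 gt2; rewrite EE => box1 box2 gt1 gt2.
have eE : E e by rewrite EE/= in_itv/= ee ltW.
have ee' : 0 < e <= eps0 by rewrite e0.
rewrite EE in subOm.
have [x [Ux y1x y2x Ju]] := perturbed_zero nN1 nN2 oOm subOm dy1 dy2 eps0_gt0
  r0 UE y1p y20 box1 box2 gt1 gt2 ee'.
pose ue x := u (e, x); pose se x := s (e, x).
(* In the coordinates [psi], these parameterise pieces of the unstable and of the stable manifold as
   graphs over [U]. *)
pose a x := wu (e, ue x); pose b x := ws (e, se x).
have dpair l (x' : 'rV[R]_l) : differentiable (fun x' : 'rV[R]_l => (e, x')) x'.
  exact: (@differentiable_pair _ _ _ _ (cst e) id).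
have EUx : (E `*` U) (e, x) by split.
have due : differentiable ue x.
  apply: (@differentiable_comp _ _ _ _ (fun x => (e, x)) u) => //.
  by apply: du.1; exact: subu.
have dse : differentiable se x.
  apply: (@differentiable_comp _ _ _ _ (fun x => (e, x)) s) => //.
  by apply: ds.1; exact: subs.
have da : differentiable a x.
  apply: (@differentiable_comp _ _ _ _ ue (fun x => wu (e, x))) => //.
  apply: (@differentiable_comp _ _ _ _ (fun x => (e, x)) wu) => //.
  by apply: dwu.1; apply: subwu; split => //; exact: uB.
have db : differentiable b x.
  apply: (@differentiable_comp _ _ _ _ se (fun x => ws (e, x))) => //.
  apply: (@differentiable_comp _ _ _ _ (fun x => (e, x)) ws) => //.
  by apply: dws.1; apply: subws; split => //; exact: sB.
have aO : O (a x) by exact: uO.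
have bO : O (b x) by exact: sO.
have yx : y (e, x) = 0.
  by rewrite -[y _]hsubmxK -/(y1 (e, x)) -/(y2 (e, x)) y1x y2x row_mx0.
(* The [x]-coordinates of both points are [x], the [y]-coordinates agree because the gap is zero,
   and [psi] is injective on [O]. *)
have ab : a x = b x.
  apply: psiI; rewrite ?inE// -[LHS]hsubmxK -[RHS]hsubmxK; congr row_mx.
    by rewrite [LHS](uE e x eE Ux) [RHS](sE e x eE Ux).
  by apply/eqP; rewrite -subr_eq0; apply/eqP.
exists (a x); split.
- by exists (ue x) => //; exact: uU'.
- by rewrite ab; exists (se x) => //; exact: sS'.
have [_ _ dcu _] := cuM e eE; have [_ _ dcs _] := csM e eE.
have tu v := tangent_space_diff v dcu (wuP e eE) oU Ux
  (fun x' => uB e x' eE) due.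
have ts v := tangent_space_diff v dcs (wsP e eE) oU Ux
  (fun x' => sB e x' eE) dse.
have psiJx := psiJ _ aO.
have dpx : differentiable psi (a x) by apply: dpsi.1.
have aJ v := graph_jacobian v oU Ux da dpx (fun x' => uE e x' eE).
have bJ : forall v, 'd b x v *m 'J psi (a x) =
    row_mx v (v *m 'J (pi_y psi \o b) x).
  move=> v; rewrite ab; apply: (graph_jacobian v oU Ux db).
    by rewrite -ab.
  by move=> x' Ux'; exact: sE.
apply: (transversal_at_graphs (a := a) (q := a x) (tu 0).1 _ psiJx _ _ aJ bJ).
- by rewrite ab; exact: (ts 0).1.
- by move=> v; exact: (tu v).2.
- by move=> v; rewrite ab; exact: (ts v).2.
have dpy c : differentiable c x -> O (c x) -> differentiable (pi_y psi \o c) x.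
  move=> dc cO.
  have dpc : differentiable (psi \o c) x.
    by apply: differentiable_comp => //; apply: dpsi.1.
  by have [] := diff_linear_comp (L := rsubmx) (@continuous_rsubmx R 1 _ _) dpc.
have day := dpy a da aO; have dby := dpy b db bO.
have dye : differentiable (fun x => y (e, x)) x by exact: differentiableB.
(* The two invertible blocks together form the derivative of the gap, which is the difference of the
   slopes of the two graphs. *)
move: Ju; rewrite (row_mx_d_x dye).
rewrite (_ : d_x y e x = 'J ((pi_y psi \o a) - (pi_y psi \o b)) x)//.
by rewrite jacobianB.
Qed.
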